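(* Let $(X,\tau)$ be an extended locally convex space and let $\tau_F$ be the flc topology for $(X,\tau)$. Then the following statements are equivalent. (1) $(X,\tau)$ is barreled. (2) $(X,\tau_F)$ is barreled. (3) Every lower semi-continuous seminorm on $(X,\tau_F)$ is continuous (with respect to $\tau_F$). (4) Every lower semi-continuous seminorm on $(X,\tau)$ is continuous (with respect to $\tau$).
   Context: Vector spaces are over $\mathbb{K}\in\{\mathbb{R},\mathbb{C}\}$. An extended seminorm on a vector space $X$ is a map $\rho:X\to[0,\infty]$ with $\rho(\alpha x)=|\alpha|\rho(x)$ (convention $0\cdot\infty=0$) and $\rho(x+y)\le\rho(x)+\rho(y)$; a seminorm is one taking only finite values. An extended locally convex space (elcs) is a vector space $X$ with a Hausdorff topology $\tau$ induced by a family $\mathcal{P}$ of extended seminorms, i.e. the sets $\{y\in X:\rho(y-x)<\epsilon\}$ ($\rho\in\mathcal{P}$, $x\in X$, $\epsilon>0$) form a subbase of $\tau$. The flc topology $\tau_F$ for an elcs $(X,\tau)$ is the finest locally convex topology (topology induced by a family of finite-valued seminorms) on $X$ that is coarser than $\tau$. A barrel in an elcs is a closed, absolutely convex (balanced and convex), absorbing subset; an elcs (in particular a locally convex space) is barreled if every barrel in it is a neighborhood of $0$. A function $f:X\to\mathbb{R}$ on a topological space is lower semi-continuous if $f^{-1}((c,\infty))$ is open for every $c\in\mathbb{R}$. *)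

(* Defs.v *)
From HB Require Import structures.
From mathcomp Require Import all_boot all_order all_algebra.
From mathcomp Require Import all_classical all_reals all_analysis.
From mathcomp Require Import complex.

Set Implicit Arguments.
Unset Strict Implicit.
Unset Printing Implicit Defensive.

Import Order.TTheory GRing.Theory Num.Theory.
Import numFieldNormedType.Exports.

Local Open Scope classical_set_scope.
Local Open Scope ring_scope.

Inductive scalar_kind := RealScalars | ComplexScalars.

Definition scalar_field (R : realType) (k : scalar_kind) : numFieldType :=
  match k with
  | RealScalars => R
  | ComplexScalars => R[i]
  end.

(* The norm `|z| of R[i] is valued in R[i] (with zero imaginary part). *)
Definition modulus (R : realType) (k : scalar_kind) : scalar_field R k -> R :=
  match k return scalar_field R k -> R with
  | RealScalars => fun a => `|a|
  | ComplexScalars => fun z => complex.Re `|z|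
  end.

Section ExtendedSeminorms.
Variables (R : realType) (k : scalar_kind) (X : lmodType (scalar_field R k)).

(* In \bar R one has 0 * +oo = 0. *)
Definition extended_seminorm (rho : X -> \bar R) : Prop :=
  [/\ forall x, (0 <= rho x)%E,
      forall a x, rho (a *: x) = ((modulus a)%:E * rho x)%E
    & forall x y, (rho (x + y)%R <= rho x + rho y)%E].

Definition seminorm (p : X -> R) : Prop := extended_seminorm (EFin \o p).

Definition seminorm_subbase (P : set (X -> \bar R)) : set (set X) :=
  [set U | exists rho x (e : R), [/\ P rho, 0 < e &
    U = [set y | (rho (y - x)%R < e%:E)%E]]].

Definition seminorm_space (P : set (X -> \bar R)) : Type := X.

HB.instance Definition _ (P : set (X -> \bar R)) :=
  Choice.on (seminorm_space P).
HB.instance Definition _ (P : set (X -> \bar R)) :=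
  isSubBaseTopological.Build (seminorm_space P) (seminorm_subbase P) id.

End ExtendedSeminorms.

(* As in the library's sup_topology, a topology on X is a structure of type
   Topological X, so that one vector space can carry several of them. *)
Definition topspace (X : Type) (tau : Topological X) : topologicalType :=
  Topological.Pack tau.

Definition coarser (X : Type) (sigma tau : Topological X) : Prop :=
  forall U : set X, @open (topspace sigma) U -> @open (topspace tau) U.

Section ExtendedLocallyConvex.
Variables (R : realType) (k : scalar_kind) (X : lmodType (scalar_field R k)).
Implicit Types tau sigma : Topological X.

Definition induced_by tau (P : set (X -> \bar R)) : Prop :=
  forall U : set X, @open (topspace tau) U <-> @open (seminorm_space P) U.

Definition extended_locally_convex tau : Prop :=
  hausdorff_space (topspace tau) /\
  exists2 P : set (X -> \bar R),
    P `<=` @extended_seminorm R k X & induced_by tau P.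

Definition locally_convex tau : Prop :=
  exists2 P : set (X -> R),
    P `<=` @seminorm R k X & induced_by tau [set EFin \o p | p in P].

Definition flc_topology tau tauF : Prop :=
  [/\ locally_convex tauF, coarser tauF tau &
      forall sigma, locally_convex sigma -> coarser sigma tau ->
        coarser sigma tauF].

Definition balanced (A : set X) : Prop :=
  forall (a : scalar_field R k) x, modulus a <= 1 -> A x -> A (a *: x).

Definition absorbing (A : set X) : Prop :=
  forall x, exists2 r : R, 0 < r &
    forall a : scalar_field R k, modulus a <= r -> A (a *: x).

Definition barrel tau (B : set X) : Prop :=
  [/\ @closed (topspace tau) B, balanced B, convex_set B & absorbing B].

Definition barreled tau : Prop :=
  forall B : set X, barrel tau B -> @nbhs _ (topspace tau) 0 B.

Definition lsc tau (f : X -> R) : Prop :=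
  forall c : R, @open (topspace tau) (f @^-1` `]c, +oo[).

Definition lsc_seminorms_continuous tau : Prop :=
  forall p : X -> R, seminorm p -> lsc tau p ->
    continuous (p : topspace tau -> R).

End ExtendedLocallyConvex.

(* Main.v *)
(** The cycle is closed with Minkowski gauges.  For an absolutely convex
absorbing set B the gauge is a finite seminorm; if B is a tau-neighbourhood of 0
it is tau-continuous, hence tauF-continuous, because the topology it induces
is locally convex and coarser than tau.

The point is that a tau-lower semi-continuous seminorm p is tauF-lower
semi-continuous.  A tau-barrel need not be tauF-closed (for the discrete
topology on the line, the open interval ]-1, 1[ is a barrel), so one exploits
the freedom to change the radius: if c < c' < p x, choose an absolutely convex
tau-neighbourhood V of 0 with p > c' on x + V.  The gauge q of
{p <= c'} + V is tauF-continuous, q x >= 1, and q <= s on {p <= c} for some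
s < 1, so {q > s} is a tauF-neighbourhood of x contained in {p > c}. *)

Require Import Defs.
From mathcomp Require Import all_boot all_order all_algebra finmap.
From mathcomp Require Import all_classical all_reals all_analysis.
From mathcomp Require Import complex lra.

Set Implicit Arguments.
Unset Strict Implicit.
Unset Printing Implicit Defensive.

Import Order.TTheory GRing.Theory Num.Theory.
Import numFieldNormedType.Exports.

Local Open Scope classical_set_scope.
Local Open Scope ring_scope.

(** * Moduli of scalars and the embedding of the reals *)

Section Scalars.
Variables (R : realType) (k : scalar_kind).
Implicit Types (r s : R) (a b : scalar_field R k).

(** Lets real dilations and convex weights be written uniformly over both scalar fields. *)
Definition real_scalar r : scalar_field R k :=
  match k return scalar_field R k with
  | RealScalars => r
  | ComplexScalars => r%:C%C
  end.

Lemma modulus_real_scalar r : modulus (real_scalar r) = `|r|.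
Proof.
rewrite /real_scalar /modulus; case: k => //.
by rewrite normc_def /= expr0n addr0 sqrtr_sqr.
Qed.

Lemma modulusM : {morph @modulus R k : a b / a * b}.
Proof.
rewrite /modulus; case: k => a b; first exact: normrM.
by rewrite normrM !normc_def /= mul0r subr0.
Qed.

Lemma modulus_ge0 a : 0 <= modulus a.
Proof.
move: a; rewrite /modulus; case: k => a; first exact: normr_ge0.
by rewrite (normc_def (a : R[i])) sqrtr_ge0.
Qed.

Lemma modulus_eq0 a : (modulus a == 0) = (a == 0).
Proof.
move: a; rewrite /modulus; case: k => a; first exact: normr_eq0.
by rewrite -(normr_eq0 a) (normc_def (a : R[i])) eq_complex /= eqxx andbT.
Qed.

Lemma modulus0 : modulus (0 : scalar_field R k) = 0.
Proof. by apply/eqP; rewrite modulus_eq0. Qed.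

Lemma modulus1 : modulus (1 : scalar_field R k) = 1.
Proof. by rewrite /modulus; case: k; rewrite normr1. Qed.

Lemma modulus_gt0 a : a != 0 -> 0 < modulus a.
Proof. by move=> a0; rewrite lt_neqAle eq_sym modulus_eq0 a0 modulus_ge0. Qed.

Lemma modulusV a : modulus a^-1 = (modulus a)^-1.
Proof.
have [->|a0] := eqVneq a 0; first by rewrite invr0 modulus0 invr0.
have m0 : modulus a != 0 by rewrite modulus_eq0.
by apply: (mulfI m0); rewrite -modulusM !divff// modulus1.
Qed.

Lemma real_scalarM : {morph real_scalar : r s / r * s}.
Proof. by rewrite /real_scalar; case: k => // r s; rewrite rmorphM. Qed.

Lemma real_scalarB : {morph real_scalar : r s / r - s}.
Proof. by rewrite /real_scalar; case: k => // r s; rewrite rmorphB. Qed.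

Lemma real_scalar1 : real_scalar 1 = 1.
Proof. by rewrite /real_scalar; case: k. Qed.

Lemma real_scalar_eq0 r : (real_scalar r == 0) = (r == 0).
Proof. by rewrite -modulus_eq0 modulus_real_scalar normr_eq0. Qed.

Lemma real_scalar0 : real_scalar 0 = 0.
Proof. by apply/eqP; rewrite real_scalar_eq0. Qed.

Lemma real_scalarN1 : real_scalar (-1) = -1.
Proof. by rewrite -sub0r real_scalarB real_scalar0 real_scalar1 sub0r. Qed.

(** The order of [R[i]] compares only numbers with equal imaginary parts, so [0 <= a] already forces
    [a] to be real. *)
Lemma unit_interval_real_scalar a :
  0 <= a <= 1 -> exists2 t : R, 0 <= t <= 1 & a = real_scalar t.
Proof.
move: a; rewrite /real_scalar; case: k => [a a01|[x y]]; first by exists a.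
rewrite !lecE /= => /andP[/andP[y0 x0] /andP[_ x1]].
by exists x; rewrite ?x0// (eqP y0).
Qed.

Lemma real_scalar_unit_interval r : 0 <= r <= 1 -> 0 <= real_scalar r <= 1.
Proof. by rewrite /real_scalar; case: k => //=; rewrite !lecE /= !eqxx. Qed.

End Scalars.
Arguments real_scalar {R} k r.

(** * Minkowski gauges and closed seminorm balls *)

Section AbsolutelyConvex.
Variables (R : realType) (k : scalar_kind) (X : lmodType (scalar_field R k)).
Local Notation "r %:S" := (real_scalar k r) (at level 2, format "r %:S").
Implicit Types (A B : set X) (p : X -> R).

Lemma convex_setP A : convex_set A <-> forall (t : R) x y, 0 <= t <= 1 ->
  A x -> A y -> A (t%:S *: x + (1 - t)%:S *: y).
Proof.
split=> [cA t x y /real_scalar_unit_interval t01 Ax Ay|cA x y t].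
  have := cA x y (Itv01 (proj1 (andP (t01 k))) (proj2 (andP (t01 k)))).
  rewrite !inE => /(_ Ax Ay).
  by rewrite real_scalarB real_scalar1.
rewrite !inE => Ax Ay.
have /unit_interval_real_scalar[r r01 tr] : 0 <= t%:num <= 1.
  by rewrite ge0 le1.
have := cA r x y r01 Ax Ay.
by rewrite real_scalarB real_scalar1 -tr.
Qed.

Lemma seminormP p : seminorm p <->
  [/\ forall x, 0 <= p x, forall a x, p (a *: x) = modulus a * p x
    & forall x y, p (x + y) <= p x + p y].
Proof.
split=> -[p0 pZ pD]; split=> /=.
- by move=> x; have := p0 x; rewrite lee_fin.
- by move=> a x; have [] := pZ a x.
- by move=> x y; have := pD x y; rewrite lee_fin.
- by move=> x; rewrite lee_fin.
- by move=> a x; rewrite pZ.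
- by move=> x y; rewrite lee_fin.
Qed.

(** The Minkowski functional of B. The infimum is meaningful when B is absorbing: the set is then
    nonempty, and 0 bounds it below. *)
Definition gauge B (x : X) : R := inf [set r | 0 < r /\ B (r^-1%:S *: x)].

Section Gauge.
Variable B : set X.
Hypotheses (Bbal : balanced B) (Bconv : convex_set B) (Babs : absorbing B).

Lemma gauge_has_inf x : has_inf [set r | 0 < r /\ B (r^-1%:S *: x)].
Proof.
split; last by exists 0 => r /= [/ltW].
have [r r0 Br] := Babs x; exists r^-1; split; first by rewrite invr_gt0.
by rewrite invrK; apply: Br; rewrite modulus_real_scalar gtr0_norm.
Qed.

Lemma gauge_ge0 x : 0 <= gauge B x.
Proof.
by apply: lb_le_inf; [exact: (gauge_has_inf x).1|move=> r [/ltW]].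
Qed.

Lemma gauge_le r x : 0 < r -> B (r^-1%:S *: x) -> gauge B x <= r.
Proof. by move=> r0 Br; apply: ge_inf => //; exact: (gauge_has_inf x).2. Qed.

(** Some s < r has x in sB, and balancedness shrinks by the factor s/r. *)
Lemma gauge_lt r x : gauge B x < r -> B (r^-1%:S *: x).
Proof.
move=> /(inf_lt (gauge_has_inf x).1)[s [s0 Bs] sr].
have r0 := lt_trans s0 sr.
have -> : r^-1%:S *: x = (s / r)%:S *: (s^-1%:S *: x).
  by rewrite scalerA -real_scalarM mulrAC divff ?mul1r ?gt_eqF.
apply: Bbal => //; rewrite modulus_real_scalar ger0_norm ?divr_ge0 ?ltW//.
by rewrite ltr_pdivrMr// mul1r.
Qed.

Lemma gauge_le1 x : B x -> gauge B x <= 1.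
Proof. by move=> Bx; apply: gauge_le;
  rewrite ?invr1 ?real_scalar1 ?scale1r. Qed.

Lemma gauge_lt1 x : gauge B x < 1 -> B x.
Proof. by move=> /gauge_lt; rewrite invr1 real_scalar1 scale1r. Qed.

(** The scalar a/|a| has modulus 1, so balancedness removes it. Equality comes later from using the
    same bound for the inverse of a. *)
Let gaugeZ_le a x : a != 0 -> gauge B (a *: x) <= modulus a * gauge B x.
Proof.
move=> a0; have m0 : 0 < modulus a by exact: modulus_gt0.
rewrite -ler_pdivrMl//; apply: lb_le_inf; first exact: (gauge_has_inf x).1.
move=> r [r0 Br]; rewrite ler_pdivrMl//; apply: gauge_le; first exact: mulr_gt0.
have -> : (modulus a * r)^-1%:S *: (a *: x) =
    ((modulus a)^-1%:S * a) *: (r^-1%:S *: x).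
  by rewrite !scalerA invfM real_scalarM mulrAC.
apply: Bbal => //; rewrite modulusM modulus_real_scalar gtr0_norm ?invr_gt0//.
by rewrite mulVf// gt_eqF.
Qed.

Lemma gauge_seminorm : seminorm (gauge B).
Proof.
apply/seminormP; split; first exact: gauge_ge0.
  move=> a x; have [->|a0] := eqVneq a 0.
    rewrite scale0r modulus0 mul0r; apply/eqP; rewrite eq_le gauge_ge0 andbT.
    (* Every e > 0 bounds the gauge at 0, since an absorbing set contains 0. *)
    apply/ler_addgt0Pr => e e0; rewrite add0r; apply: gauge_le => //.
    have [r r0 /(_ 0)] := Babs 0; rewrite !scaler0; apply.
    by rewrite modulus0 ltW.
  apply/eqP; rewrite eq_le gaugeZ_le//=.
  have m0 : 0 < modulus a by exact: modulus_gt0.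
  rewrite -ler_pdivlMl// -modulusV; have := @gaugeZ_le a^-1 (a *: x).
  by rewrite scalerA mulVf// scale1r; apply; rewrite invr_eq0.
move=> x y; apply/ler_addgt0Pr => e e0.
(* As x is in rB and y in sB, (x + y)/(r + s) is the convex combination of x/r and y/s with weight
   r/(r + s). *)
pose r := gauge B x + e / 2; pose s := gauge B y + e / 2.
have r0 : 0 < r by have := gauge_ge0 x; rewrite /r; lra.
have s0 : 0 < s by have := gauge_ge0 y; rewrite /s; lra.
have -> : gauge B x + gauge B y + e = r + s by rewrite /r /s; lra.
apply: gauge_le; first exact: addr_gt0.
have Bx : B (r^-1%:S *: x) by apply: gauge_lt; rewrite ltrDl divr_gt0.
have By : B (s^-1%:S *: y) by apply: gauge_lt; rewrite ltrDl divr_gt0.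
have rs0 : r + s != 0 by rewrite gt_eqF// addr_gt0.
have := (convex_setP B).1 Bconv (r / (r + s)) _ _ _ Bx By.
have -> : 1 - r / (r + s) = s / (r + s).
  by apply: (mulIf rs0); rewrite mulrBl !divfK// mul1r addrAC subrr add0r.
rewrite !scalerA -!real_scalarM ![_ / (r + s) / _]mulrAC !divff ?gt_eqF//.
rewrite !mul1r -scalerDr; apply; apply/andP; split.
  exact: (divr_ge0 (ltW r0) (ltW (addr_gt0 r0 s0))).
by rewrite (ler_pdivrMr _ _ (addr_gt0 r0 s0)) mul1r lerDl (ltW s0).
Qed.

End Gauge.

Section SeminormTheory.
Variable p : X -> R.
Hypothesis pN : seminorm p.

Lemma seminorm_real_scale (t : R) x : 0 <= t -> p (t%:S *: x) = t * p x.
Proof.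
move=> t0; have /seminormP[_ -> _] := pN.
by rewrite modulus_real_scalar ger0_norm.
Qed.

Lemma seminorm0 : p 0 = 0.
Proof.
by rewrite -[0](scaler0 X 0%:S) seminorm_real_scale// mul0r.
Qed.

Lemma seminorm_sub_le x y : `|p x - p y| <= p (x - y).
Proof.
have /seminormP[_ pZ pD] := pN.
have pC : p (y - x) = p (x - y).
  by rewrite -(opprB x y) -(scaleN1r (x - y)) pZ -real_scalarN1
    modulus_real_scalar normrN1 mul1r.
rewrite ler_norml; have := pD (x - y) y; have := pD (y - x) x.
by rewrite !subrK pC; lra.
Qed.

Variables (c : R) (c0 : 0 < c).

Lemma seminorm_ball_balanced : balanced [set x | p x <= c].
Proof.
have /seminormP[p0 pZ _] := pN.
move=> a x a1 /= pc; rewrite pZ (le_trans _ pc)//.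
by rewrite ler_piMl.
Qed.

Lemma seminorm_ball_convex : convex_set [set x | p x <= c].
Proof.
have /seminormP[p0 _ pD] := pN.
apply/convex_setP => t x y /andP[t0 t1] /= px py.
rewrite (le_trans (pD _ _))// !seminorm_real_scale ?subr_ge0//.
by move: (p0 x) (p0 y); nra.
Qed.

Lemma seminorm_ball_absorbing : absorbing [set x | p x <= c].
Proof.
(* Adding 1 keeps the denominator positive when p vanishes at x. *)
have /seminormP[p0 pZ _] := pN => x; have px1 : 0 < p x + 1 by have := p0 x;
  lra.
exists (c / (p x + 1)); first exact: divr_gt0.
move=> a /= am; rewrite pZ (le_trans (ler_wpM2r (p0 x) am))//.
by rewrite mulrAC ler_pdivrMr// ler_pM2l//; lra.
Qed.

End SeminormTheory.

End AbsolutelyConvex.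

(** * Topologies induced by extended seminorms *)

Section SeminormTopologies.
Variables (R : realType) (k : scalar_kind) (X : lmodType (scalar_field R k)).
Local Notation "r %:S" := (real_scalar k r) (at level 2, format "r %:S").
Implicit Types (P : set (X -> \bar R)) (tau tauF : Topological X)
  (A B U V : set X) (p : X -> R).

Lemma seminorm_space_open P rho x (e : R) : P rho -> 0 < e ->
  @open (seminorm_space P) [set y | (rho (y - x)%R < e%:E)%E].
Proof.
move=> Prho e0.
exists [set [set y | (rho (y - x)%R < e%:E)%E]]; last by rewrite bigcup_set1.
by move=> _ ->; apply: finI_from1; exists rho, x, e.
Qed.

Lemma seminorm_space_openE P U x : @open (seminorm_space P) U -> U x ->
  exists2 D : {fset set X}, {in D, forall V, seminorm_subbase P V /\ V x} &
    \bigcap_(V in [set` D]) V `<=` U.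
Proof.
move=> [F FP <-] [V FV Vx]; have [D DP DV] := FP V FV; exists D.
  move=> W WD; split; first by have := DP _ WD; rewrite inE.
  by move: Vx; rewrite -DV; apply.
by rewrite DV => y Vy; exists V.
Qed.

(** Preimages commute with finite intersections, and neighbourhood filters are closed under them, so
    testing the subbase suffices. *)
Lemma open_preimage_seminorm_space P (T : topologicalType) (f : T -> X) :
  (forall rho x (e : R), P rho -> 0 < e ->
    open [set t | (rho (f t - x)%R < e%:E)%E]) ->
  forall U, @open (seminorm_space P) U -> open (f @^-1` U).
Proof.
move=> fP U /seminorm_space_openE oU; rewrite openE => t /= /oU[D DP DU].
apply: filterS (_ : nbhs t (\bigcap_(V in [set` D]) f @^-1` V)).
  by move=> s Ds; apply: DU => V /Ds.
apply: filter_bigI => V /DP [[rho [x [e [Prho e0 ->]]]] Vt].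
by apply: open_nbhs_nbhs; split => //; exact: fP.
Qed.

(** Covers extended locally convex and locally convex topologies at once, so the lemmas below serve
    both [tau] and [tauF]. *)
Definition extended_seminormed tau :=
  exists2 P, P `<=` @extended_seminorm R k X & induced_by tau P.

Lemma locally_convex_seminormed tau :
  Defs.locally_convex tau -> extended_seminormed tau.
Proof.
by move=> [P sP indP]; exists [set EFin \o p | p in P] => // _ [p /sP + <-].
Qed.

Section ExtendedSeminormed.
Variables (tau : Topological X) (tauP : extended_seminormed tau).

(** The preimage of a subbasic ball is again one, with radius divided by |c|. The scalar stays
    fixed: where rho is infinite, scaling need not be continuous in the scalar. *)
Lemma affine_continuous (c : scalar_field R k) (a : X) : c != 0 ->
  continuous ((fun y => c *: (y - a)) : topspace tau -> topspace tau).
Proof.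
move=> c0; apply/continuousP => U; have [P Pext indP] := tauP.
move=> /indP oU; apply/indP; move: U oU.
apply: (@open_preimage_seminorm_space P (seminorm_space P)) => rho x e Prho e0.
have -> : [set t | (rho (c *: (t - a) - x)%R < e%:E)%E] =
    [set t | (rho (t - (a + c^-1 *: x))%R < (e / modulus c)%:E)%E].
  rewrite predeqE => t /=.
  have -> : c *: (t - a) - x = c *: (t - (a + c^-1 *: x)).
    by rewrite opprD addrA [in RHS]scalerBr scalerA divff// scale1r.
  have [_ -> _] := Pext _ Prho.
  by rewrite EFinM lte_pdivlMr ?modulus_gt0// muleC.
by apply: seminorm_space_open => //; rewrite divr_gt0// modulus_gt0.
Qed.

Lemma open_affine_preimage (c : scalar_field R k) (a : X) U : c != 0 ->
  @open (topspace tau) U -> @open (topspace tau) [set y | U (c *: (y - a))].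
Proof. by move=> /(affine_continuous (a := a))/continuousP; apply. Qed.

(** A subbasic ball containing 0 contains a ball centred at 0; finitely many such centred balls are
    then intersected. *)
Lemma nbhs0_absolutely_convex U : @open (topspace tau) U -> U 0 ->
  exists V, [/\ balanced V, convex_set V, @nbhs _ (topspace tau) 0 V & V `<=`
    U].
Proof.
have [P Pext indP] := tauP; move=> /indP/seminorm_space_openE oU /oU[D DP DU].
pose G V W := [/\ balanced W, convex_set W, @nbhs _ (topspace tau) 0 W & W `<=`
  V].
have /(_ _)/cid DG : forall V, exists W, V \in D -> G V W.
  move=> V; have [VD|_] := boolP (V \in D); last by exists setT.
  have [[rho [x [e [Prho e0 ->]]]] /= x0] := DP _ VD.
  have [rho0 rhoZ rhoD] := Pext _ Prho.
  have rhox : rho (0 - x) \is a fin_num.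
    by rewrite ge0_fin_numE// (lt_trans x0) ?ltry.
  (* The gap left by the triangle inequality; rho is finite at -x because it is below e there. *)
  pose d := e - fine (rho (0 - x)).
  have d0 : 0 < d by rewrite subr_gt0 -lte_fin fineK.
  exists [set y | (rho y < d%:E)%E] => _; split.
  - move=> a y a1 /=; apply: le_lt_trans; rewrite rhoZ.
    by rewrite gee_pMl// ?lee_fin// modulus_ge0.
  - apply/convex_setP => t y z /andP[t0 t1] /= yd zd.
    rewrite (le_lt_trans (rhoD _ _))// !rhoZ !modulus_real_scalar.
    rewrite !ger0_norm ?subr_ge0//.
    have yf : rho y \is a fin_num by rewrite ge0_fin_numE// (lt_trans yd) ?ltry.
    have zf : rho z \is a fin_num by rewrite ge0_fin_numE// (lt_trans zd) ?ltry.
    move: yd zd; rewrite -(fineK yf) -(fineK zf) -!EFinM -EFinD !lte_fin.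
    set a := fine _; set b := fine _ => ad bd.
    (* Passing through the maximum keeps the inequality strict even when a weight is 0. *)
    have md : Num.max a b < d by rewrite gt_max ad.
    apply: le_lt_trans md.
    have : a <= Num.max a b by rewrite le_max lexx.
    have : b <= Num.max a b by rewrite le_max lexx orbT.
    by nra.
  - apply: open_nbhs_nbhs; split.
      have := @seminorm_space_open P rho 0 d Prho d0.
      by under eq_set do rewrite subr0; move/indP.
    by rewrite /= -(scale0r 0) rhoZ modulus0 mul0e lte_fin.
  - move=> y /= yd; rewrite -[- x]sub0r (le_lt_trans (rhoD _ _))//.
    by rewrite -[e](subrK (fine (rho (0 - x)))) EFinD fineK// lteD2rE.
pose W V := sval (DG V).
have WG V : V \in D -> G V (W V) by rewrite /W; case: (DG V).
exists (\bigcap_(V in [set` D]) W V); split.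
- by move=> a x a1 Wx V VD; have [+ _ _ _] := WG _ VD; apply => //; exact: Wx.
- apply/convex_setP => t x y t01 Wx Wy V VD;
  have [_ /convex_setP + _ _] := WG _ VD.
  by apply => //; [exact: Wx|exact: Wy].
- by apply: filter_bigI => V VD; have [] := WG _ VD.
- by move=> x Wx; apply: DU => V VD; have [_ _ _] := WG _ VD; apply; exact: Wx.
Qed.

Lemma nbhs0_seminorm_continuous p : seminorm p ->
  @nbhs _ (topspace tau) 0 [set x | p x <= 1] ->
  continuous (p : topspace tau -> R).
Proof.
move=> pN p1 x; apply/cvgrPdist_lt => e e0.
(* The factor 2 makes the pulled-back closed unit ball give p (y - x) <= e/2, hence a strict bound
   by e. *)
have e20 : (2 / e)%:S != 0 by rewrite real_scalar_eq0 gt_eqF// divr_gt0.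
have := affine_continuous (a := x) e20 (x := x);
  rewrite /continuous_at /= subrr scaler0.
move=> /(_ _ p1) xp; apply: filterS (xp : nbhs x _) => y /=.
rewrite (seminorm_real_scale pN _ (ltW (divr_gt0 _ e0)))// => ye.
rewrite distrC (le_lt_trans (seminorm_sub_le pN y x))//.
by move: ye; rewrite mulrAC ler_pdivrMr// mul1r; have := e0; lra.
Qed.

Lemma continuous_open_lt p : continuous (p : topspace tau -> R) ->
  forall c : R, @open (topspace tau) [set x | p x < c].
Proof. by move=> + c; move=> /continuousP/(_ _ (@open_lt R c)). Qed.

Lemma gauge_continuous B : balanced B -> convex_set B -> absorbing B ->
  @nbhs _ (topspace tau) 0 B -> continuous (gauge B : topspace tau -> R).
Proof.
move=> Bb Bc Ba B0; apply: nbhs0_seminorm_continuous;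
  first exact: gauge_seminorm.
by apply: filterS B0 => x; exact: (gauge_le1 Ba).
Qed.

(** For t strictly between c and the gauge at x, tB is closed and misses x, and outside tB the gauge
    is at least t. *)
Lemma gauge_lsc B : barrel tau B -> lsc tau (gauge B).
Proof.
move=> [Bcl Bb Bc Ba] c; have [c0|c0] := ltP c 0.
  rewrite (_ : _ @^-1` _ = setT); first exact: openT.
  by apply/seteqP; split=> // x _;
    rewrite /= in_itv/= andbT (lt_le_trans c0)// gauge_ge0.
rewrite openE => x /=; rewrite in_itv/= andbT => cx.
pose t := (c + gauge B x) / 2; have t0 : 0 < t by rewrite /t; lra.
have tV0 : t^-1%:S != 0 by rewrite real_scalar_eq0 invr_neq0// gt_eqF.
have := @open_affine_preimage _ 0 _ tV0 (closed_openC Bcl).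
rewrite openE => /(_ x); rewrite /= subr0 => H.
apply: filterS (H _).
  move=> y /=; rewrite subr0 in_itv/= andbT => yB.
  rewrite ltNge; apply/negP => yc; apply: yB.
  by apply: gauge_lt => //; rewrite /t; lra.
by move=> /(gauge_le Ba t0); rewrite /t; lra.
Qed.

End ExtendedSeminormed.

Lemma barrel_unit_ball tau p : seminorm p -> lsc tau p ->
  barrel tau [set x | p x <= 1].
Proof.
move=> pN plsc; split.
- rewrite (_ : mkset _ = ~` (p @^-1` `]1, +oo[)); first exact: open_closedC.
  by apply/seteqP; split=> x /=; rewrite in_itv/= andbT leNgt => /negP.
- exact: seminorm_ball_balanced.
- exact: seminorm_ball_convex.
- exact: seminorm_ball_absorbing.
Qed.

Lemma continuous_coarser tau sigma p : coarser sigma tau ->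
  continuous (p : topspace sigma -> R) -> continuous (p : topspace tau -> R).
Proof.
by move=> st /continuousP pc; apply/continuousP => U /pc; exact: st.
Qed.

(** * Passing from [tau] to the flc topology *)

Section Flc.
Variables (tau tauF : Topological X).
Hypotheses (tauP : extended_seminormed tau) (tauFP : flc_topology tau tauF).

Let tauF_seminormed : extended_seminormed tauF.
Proof. by apply: locally_convex_seminormed; case: tauFP. Qed.

Lemma flc_seminorm_continuous p : seminorm p ->
  continuous (p : topspace tau -> R) -> continuous (p : topspace tauF -> R).
Proof.
move=> pN pc; apply: nbhs0_seminorm_continuous => //.
pose P := [set EFin \o q | q in [set p]].
pose sigma : Topological X := Topological.class (seminorm_space P).
have sigma_lc : Defs.locally_convex sigma by exists [set p] => // _ ->.
have sigma_tau : coarser sigma tau.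
  (* Subbasic sets of [sigma] are translates of the sets where p < e, which are [tau]-open. *)
  apply: (@open_preimage_seminorm_space P (topspace tau) id) => _ x e [_ -> <-]
    e0.
  have := @open_affine_preimage _ tauP 1 x _ (oner_neq0 _) (continuous_open_lt
    pc e).
  by congr open; apply/seteqP; split=> y /=; rewrite scale1r lte_fin.
have [_ _ /(_ _ sigma_lc sigma_tau) H] := tauFP.
apply: filterS (_ : @nbhs _ (topspace tauF) 0 [set y | p y < 1]).
  by move=> y /ltW.
apply: open_nbhs_nbhs; split; last by rewrite /= seminorm0.
apply: H; have Pp : P (EFin \o p) by exists p.
have := @seminorm_space_open P (EFin \o p) 0 1 Pp ltr01.
by congr open; apply/seteqP; split=> y /=; rewrite subr0 lte_fin.
Qed.

Lemma flc_lsc p : seminorm p -> lsc tau p -> lsc tauF p.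
Proof.
move=> pN plsc c; have /seminormP[p0 _ pD] := pN.
have [c0|c0] := ltP c 0.
  rewrite (_ : _ @^-1` _ = setT); first exact: openT.
  by apply/seteqP; split=> // x _; rewrite /= in_itv/= andbT (lt_le_trans c0).
rewrite openE => x /=; rewrite in_itv/= andbT => cx.
pose c' := (c + p x) / 2; have c'0 : 0 < c' by rewrite /c'; lra.
have [V [Vb Vc V0 VU]] : exists V, [/\ balanced V, convex_set V,
    @nbhs _ (topspace tau) 0 V & V `<=` [set y | c' < p (y + x)]].
  apply: nbhs0_absolutely_convex => //; last by rewrite /= add0r /c'; lra.
  have := @open_affine_preimage _ tauP 1 (- x) _ (oner_neq0 _) (plsc c').
  by congr open; apply/seteqP; split=> y /=;
    rewrite scale1r opprK in_itv/= andbT.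
have V00 : V 0 by exact: nbhs_singleton V0.
(* The summand {p <= c'} makes D absorbing, and V makes it a [tau]-neighbourhood of 0. *)
pose D := [set y | exists u v, [/\ p u <= c', V v & y = u + v]].
have Db : balanced D.
  move=> a _ a1 [u [v [uc Vv ->]]]; exists (a *: u), (a *: v); split.
  - exact: (seminorm_ball_balanced pN).
  - exact: Vb.
  - by rewrite scalerDr.
have Dc : convex_set D.
  apply/convex_setP => t _ _ t01 [u [v [uc Vv ->]]] [u' [v' [uc' Vv' ->]]].
  exists (t%:S *: u + (1 - t)%:S *: u'), (t%:S *: v + (1 - t)%:S *: v'); split.
  - exact: ((convex_setP _).1 (seminorm_ball_convex pN (c := c'))).
  - exact: ((convex_setP _).1 Vc).
  - by rewrite !scalerDr addrACA.
have Dball y : p y <= c' -> D y by move=> yc; exists y, 0; rewrite addr0.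
have Da : absorbing D.
  move=> y; have [r r0 ry] := seminorm_ball_absorbing pN c'0 y.
  by exists r => // a /ry /Dball.
have D0 : @nbhs _ (topspace tau) 0 D.
  by apply: filterS V0 => v Vv; exists 0, v; rewrite add0r seminorm0// ltW.
(* If x = u + v, then u = x - v with -v in V by balancedness, so p u > c', a contradiction. *)
have Dx : ~ D x.
  move=> [u [v [uc Vv xuv]]].
  have /VU /= : V (- v).
    by rewrite -scaleN1r -real_scalarN1; apply: Vb => //;
      rewrite modulus_real_scalar normrN1.
  by rewrite xuv addrC addrK ltNge uc.
have qc := flc_seminorm_continuous (gauge_seminorm Db Dc Da)
  (gauge_continuous tauP Db Dc Da D0).
(* The midpoint of c and c' over c': it lies strictly between c/c' and 1, and stays positive when c
   = 0. Then p y <= c puts y in sD. *)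
pose s := (c + c') / 2 / c'.
have s0 : 0 < s by rewrite /s divr_gt0//; lra.
have s1 : s < 1 by rewrite /s ltr_pdivrMr// mul1r /c'; lra.
have /continuousP/(_ _ (@open_gt R s)) := qc.
rewrite openE => /(_ x) H; apply: filterS (H _).
  move=> y /=; rewrite in_itv/= andbT !ltNge; apply: contra => yc.
  apply: (gauge_le Da) => //; apply: Dball;
    have sV0 : 0 <= s^-1 by rewrite invr_ge0 ltW.
  by rewrite seminorm_real_scale// ler_pdivrMl// /s divfK ?gt_eqF// /c'; lra.
rewrite /= (lt_le_trans s1)// leNgt; apply/negP => qx.
exact: Dx (gauge_lt1 Db Da qx).
Qed.

End Flc.

End SeminormTopologies.

(** * The cycle of four implications *)

Theorem theorem3p15 (R : realType) (k : scalar_kind)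
    (X : lmodType (scalar_field R k)) (tau tauF : Topological X) :
  extended_locally_convex tau -> flc_topology tau tauF ->
  [<-> barreled tau;
       barreled tauF;
       lsc_seminorms_continuous tauF;
       lsc_seminorms_continuous tau].
Proof.
move=> [_ tauP] tauFP; have [tauF_lc tauF_tau _] := tauFP.
have tauF_seminormed := locally_convex_seminormed tauF_lc.
tfae.
- move=> tau_barreled B [Bcl Bb Bc Ba].
  (* As [tauF] is coarser, a [tauF]-barrel is [tau]-closed, hence a [tau]-barrel; its gauge carries
     the conclusion back to [tauF]. *)
  have B0 : @nbhs _ (topspace tau) 0 B.
    apply: tau_barreled; split=> //; rewrite -(setCK B); apply: open_closedC.
    by apply: tauF_tau; exact: closed_openC.
  have qN := gauge_seminorm Bb Bc Ba.
  have qc := flc_seminorm_continuous tauP tauFP qN (gauge_continuous tauP Bb Bc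
    Ba B0).
  apply: filterS (_ : @nbhs _ (topspace tauF) 0 [set x | gauge B x < 1]).
    by move=> x; exact: gauge_lt1.
  apply: open_nbhs_nbhs; split; first exact: continuous_open_lt.
  by rewrite /= (seminorm0 qN).
- move=> tauF_barreled p pN plsc; apply: nbhs0_seminorm_continuous => //.
  by apply: tauF_barreled; exact: barrel_unit_ball.
- move=> tauF_lsc p pN plsc; apply: (continuous_coarser tauF_tau).
  by apply: tauF_lsc => //; exact: (flc_lsc tauP tauFP).
(* The gauge of a barrel is lower semi-continuous, hence continuous, and its open unit ball lies in
   the barrel. *)
- move=> tau_lsc B Bbar; have [_ Bb Bc Ba] := Bbar.
  have qN := gauge_seminorm Bb Bc Ba.
  have qc := tau_lsc _ qN (gauge_lsc tauP Bbar).
  apply: filterS (_ : @nbhs _ (topspace tau) 0 [set x | gauge B x < 1]).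
    by move=> x; exact: gauge_lt1.
  apply: open_nbhs_nbhs; split; first exact: continuous_open_lt.
  by rewrite /= (seminorm0 qN).
Qed.
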